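(* Let $n\ge 2$, let $\mathscr{C}_H\subseteq\mathbb{F}_2^{2^n-1}$ be the $[2^n-1,\,2^n-1-n,\,3]$ Hamming code, let $\mathcal{C}_e$ be its set of even-weight codewords, and let $A$ be the adjacency matrix of the graph $G_4$ on $\mathcal{C}_e$ in which two elements are adjacent iff their Hamming distance is $4$. Let $\mathbf{u}\in\mathbb{F}_2^{2^n-1}$ be the punctured truth table of a function $f_{\mathbf{u}}:\mathbb{F}_2^n\to\{0,1\}$ satisfying $f_{\mathbf{u}}(\mathbf{0})=0$, and for $\mathbf{a}\in\mathbb{F}_2^n$ let $$W_{f_{\mathbf{u}}}(\mathbf{a})=\sum_{\mathbf{x}\in\mathbb{F}_2^n}(-1)^{f_{\mathbf{u}}(\mathbf{x})+\mathbf{a}\cdot\mathbf{x}}.$$ Then the eigenvalue $\lambda_{\mathbf{u}}=\sum_{\mathbf{s}\in\mathcal{C}_e,\ \mathrm{wt}(\mathbf{s})=4}(-1)^{\mathbf{u}\cdot\mathbf{s}}$ of $A$ corresponding to the eigenvector $\mathbf{e}_{\mathbf{u}}=\bigl[(-1)^{\mathbf{u}\cdot\mathbf{v}}\bigr]_{\mathbf{v}\in\mathcal{C}_e}$ satisfies $$24\,\lambda_{\mathbf{u}}=\frac{1}{2^n}\sum_{\mathbf{a}\in\mathbb{F}_2^n}\Bigl(W_{f_{\mathbf{u}}}(\mathbf{a})^4-4\,W_{f_{\mathbf{u}}}(\mathbf{a})^3\Bigr)-3\cdot 2^{2n}+14\cdot 2^n-8.$$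
   Context: The $[2^n-1,\,2^n-1-n,\,3]$ Hamming code is the kernel over $\mathbb{F}_2$ of the $n\times(2^n-1)$ matrix $H$ whose columns are all the nonzero vectors of $\mathbb{F}_2^n$, listed in lexicographic order. The truth table of $f:\mathbb{F}_2^n\to\{0,1\}$ is the vector $(f(\mathbf{x}_i))_{i=1}^{2^n}\in\mathbb{F}_2^{2^n}$ with $\mathbf{x}_1,\ldots,\mathbf{x}_{2^n}$ the elements of $\mathbb{F}_2^n$ in lexicographic order; the punctured truth table in $\mathbb{F}_2^{2^n-1}$ is obtained by removing the first entry $f(\mathbf{0})$. Thus coordinate $i$ of $\mathbf{u}$ is the value of $f_{\mathbf{u}}$ at the $i$-th column of $H$. $\mathbf{u}\cdot\mathbf{v}$ is the $\mathbb{F}_2$ inner product and $\mathrm{wt}$ is Hamming weight. *)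

(* Defs.v *)
From HB Require Import structures.
From mathcomp Require Import all_boot all_order all_algebra.

Set Implicit Arguments.
Unset Strict Implicit.
Unset Printing Implicit Defensive.

Import Order.TTheory GRing.Theory Num.Theory.
Local Open Scope ring_scope.

(* The word x_1 ... x_n, carrying the library's lexicographic order on
   sequences of naturals (0 < 1, leftmost coordinate most significant). *)
Definition lex_word (n : nat) (x : 'rV['F_2]_n) : seqlexi nat :=
  [seq nat_of_ord (x 0 i) | i <- enum 'I_n].

Definition lex_le (n : nat) : rel 'rV['F_2]_n :=
  fun x y => (lex_word x <= lex_word y)%O.

Definition lex_enum (n : nat) : seq 'rV['F_2]_n :=
  sort (@lex_le n) (enum {: 'rV['F_2]_n}).

Definition truth_table (n : nat) (f : 'rV['F_2]_n -> 'F_2) : 'rV['F_2]_(2 ^ n) :=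
  \row_(i < 2 ^ n) f (nth 0 (lex_enum n) i).

Definition first_index (n : nat) : 'I_(2 ^ n) := Ordinal (expn_gt0 2 n).

Definition punctured_truth_table (n : nat) (f : 'rV['F_2]_n -> 'F_2) :
    'rV['F_2]_(2 ^ n).-1 :=
  col' (first_index n) (truth_table f).

Definition hammingH (n : nat) : 'M['F_2]_(n, (2 ^ n).-1) :=
  \matrix_(i, j) nth 0 [seq x <- lex_enum n | x != 0] j 0 i.

Definition dotF2 (m : nat) (u v : 'rV['F_2]_m) : 'F_2 := \sum_(i < m) u 0 i * v 0 i.

Definition wt (m : nat) (v : 'rV['F_2]_m) : nat := #|[set i | v 0 i != 0]|.

Definition hamming_dist (m : nat) (u v : 'rV['F_2]_m) : nat :=
  #|[set i | u 0 i != v 0 i]|.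

Definition hamming_code (n : nat) : {set 'rV['F_2]_(2 ^ n).-1} :=
  [set v | hammingH n *m v^T == 0].

Definition even_code (n : nat) : {set 'rV['F_2]_(2 ^ n).-1} :=
  [set v in hamming_code n | ~~ odd (wt v)].

Definition G4 (n : nat) : rel 'rV['F_2]_(2 ^ n).-1 :=
  fun v w => hamming_dist v w == 4.

(* Rows and columns are indexed by S through its enumeration [enum_val]. *)
Definition adjacency_mx (R : pzRingType) (T : finType) (S : {set T}) (e : rel T) :
    'M[R]_#|S| :=
  \matrix_(i, j) (e (enum_val i) (enum_val j))%:R.

(* The exponent is the representative of c in {0, 1}. *)
Definition signF2 (R : pzRingType) (c : 'F_2) : R := (-1) ^+ nat_of_ord c.

Definition char_vec (R : pzRingType) (n : nat) (u : 'rV['F_2]_(2 ^ n).-1) :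
    'cV[R]_#|even_code n| :=
  \col_i signF2 R (dotF2 u (enum_val i)).

Definition lambda (R : pzRingType) (n : nat) (u : 'rV['F_2]_(2 ^ n).-1) : R :=
  \sum_(s in even_code n | wt s == 4) signF2 R (dotF2 u s).

Definition walsh (R : pzRingType) (n : nat) (f : 'rV['F_2]_n -> 'F_2)
    (a : 'rV['F_2]_n) : R :=
  \sum_(x : 'rV['F_2]_n) signF2 R (f x + dotF2 a x).

(* Main.v *)
(* The condition H s = 0 is detected by averaging (-1)^(a . H s) over a, so
   2^n lambda_u is the sum over a of e_4, the fourth elementary symmetric
   function of the signs h_a(x) = (-1)^(f x + a . x), x <> 0. Since h_a(x)^2 = 1
   and f 0 = 0, the power sums of h_a are W(a) - 1 (odd exponents) and 2^n - 1
   (even exponents), and Newton's identities make 24 e_4 a quartic polynomial in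
   W(a). Its lower-order terms are evaluated by the inversion formula
   sum_a W(a) = 2^n and Parseval's identity sum_a W(a)^2 = 4^n. *)
Require Import Defs.
From HB Require Import structures.
From mathcomp Require Import all_boot all_order all_algebra.
From mathcomp Require Import ring.

Set Implicit Arguments.
Unset Strict Implicit.
Unset Printing Implicit Defensive.

Import Order.TTheory GRing.Theory Num.Theory.
Local Open Scope ring_scope.

(** * Signs and characters over ['F_2] *)

Lemma F2_cases (c : 'F_2) : c = 0 \/ c = 1.
Proof. by case: c => [[|[|m]] // ltm]; [left | right]; apply: val_inj. Qed.

Lemma signF2_0 (R : pzRingType) : signF2 R 0 = 1.
Proof. by []. Qed.

Lemma signF2_1 (R : pzRingType) : signF2 R 1 = -1.
Proof. by []. Qed.

Lemma signF2D (R : pzRingType) (c d : 'F_2) :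
  signF2 R (c + d) = signF2 R c * signF2 R d.
Proof.
have add11 : 1 + 1 = 0 :> 'F_2 by apply: val_inj.
by case: (F2_cases c) => ->; case: (F2_cases d) => ->;
  rewrite ?add11 ?addr0 ?add0r ?signF2_0 ?signF2_1 ?mulrNN ?mulr1 ?mul1r.
Qed.

Lemma signF2_sqr (R : pzRingType) (c : 'F_2) : signF2 R c ^+ 2 = 1.
Proof. by case: (F2_cases c) => ->; rewrite ?signF2_1 ?sqrrN expr1n. Qed.

Lemma signF2_sum (R : comPzRingType) (I : finType) (F : I -> 'F_2) :
  signF2 R (\sum_i F i) = \prod_i signF2 R (F i).
Proof. exact: (big_morph _ (@signF2D R) (signF2_0 R)). Qed.

Lemma dotF2C (m : nat) (u v : 'rV['F_2]_m) : dotF2 u v = dotF2 v u.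
Proof. by apply: eq_bigr => i _; rewrite mulrC. Qed.

Lemma dotF2Dr (m : nat) (u v w : 'rV['F_2]_m) :
  dotF2 u (v + w) = dotF2 u v + dotF2 u w.
Proof. by rewrite -big_split; apply: eq_bigr => i _; rewrite mxE mulrDr. Qed.

Lemma dotF2_0r (m : nat) (u : 'rV['F_2]_m) : dotF2 u 0 = 0.
Proof. by apply: big1 => i _; rewrite mxE mulr0. Qed.

(** Orthogonality of characters: if [v] has a nonzero coordinate [i], translating [a] by the unit
    vector at [i] flips every sign, so the sum is its own negative and vanishes in characteristic
    0. *)
Lemma sum_signF2_dotF2 (R : numFieldType) (n : nat) (v : 'rV['F_2]_n) :
  \sum_(a : 'rV['F_2]_n) signF2 R (dotF2 a v) = (v == 0)%:R * 2%:R ^+ n.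
Proof.
have [->|/rV0Pn[i vi_neq0]] := eqVneq v 0.
  under eq_bigr do rewrite dotF2_0r signF2_0.
  by rewrite sumr_const card_mx card_Fp // mul1n mul1r natrX.
have vi1 : v 0 i = 1 by case: (F2_cases (v 0 i)) vi_neq0 => -> //; rewrite eqxx.
have dot_delta : dotF2 v (delta_mx 0 i) = 1.
  rewrite /dotF2 (bigD1 i) //= mxE !eqxx mulr1 vi1 big1 ?addr0 // => j ji.
  by rewrite mxE (negPf ji) andbF mulr0.
set S := \sum_a _; suff: S *+ 2 == 0 by rewrite mulrn_eq0 /= mul0r => /eqP.
rewrite mulr2n addr_eq0 {1}/S (reindex_inj (addIr (delta_mx 0 i))) /= -sumrN.
apply/eqP/eq_bigr => a _.
by rewrite dotF2C dotF2Dr dot_delta signF2D signF2_1 mulrN1 dotF2C.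
Qed.

(** * Lexicographic enumeration and the columns of H *)

Lemma lex_word_inj (n : nat) : injective (@lex_word n).
Proof.
move=> x y /eq_in_map eqxy; apply/rowP => i.
by apply/val_inj/eqxy; rewrite mem_enum.
Qed.

Lemma lex_le_trans (n : nat) : transitive (@lex_le n).
Proof. by move=> y x z; apply: le_trans. Qed.

Lemma lex_le_total (n : nat) : total (@lex_le n).
Proof. by move=> x y; apply: le_total. Qed.

Lemma lex_le0 (n : nat) (x : 'rV['F_2]_n) : lex_le 0 x.
Proof.
rewrite /lex_le /lex_word; elim: (enum 'I_n) => //= i s IHs.
by rewrite Order.SeqLexiOrder.lexi_cons mxE leEnat /= IHs implybT.
Qed.

Lemma mem_lex_enum (n : nat) (x : 'rV['F_2]_n) : x \in lex_enum n.
Proof. by rewrite mem_sort mem_enum. Qed.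

Lemma lex_enum_uniq (n : nat) : uniq (lex_enum n).
Proof. by rewrite sort_uniq enum_uniq. Qed.

Lemma size_lex_enum (n : nat) : size (lex_enum n) = (2 ^ n)%N.
Proof. by rewrite size_sort -cardT card_mx card_Fp // mul1n. Qed.

(** The zero word is the least one, so puncturing the truth table and discarding the zero column
    shift the indices in the same way. *)
Lemma lex_enumE (n : nat) : lex_enum n = 0 :: [seq x <- lex_enum n | x != 0].
Proof.
have := sort_sorted (@lex_le_total n) (enum {: 'rV['F_2]_n}).
have := lex_enum_uniq n; have := mem_lex_enum (0 : 'rV['F_2]_n).
rewrite -/(lex_enum n); case: (lex_enum n) => //= y s.
rewrite inE => y0s /andP[ys _].
rewrite (path_sortedE (@lex_le_trans n)) => /andP[/allP le_ys _].
have y0 : y = 0.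
  (* If 0 came after the head [y], sortedness would give [y] below 0, and minimality of 0 forces
     equality. *)
  case/orP: y0s => [/eqP-> //|/le_ys le_y0].
  by apply: lex_word_inj; apply/le_anti/andP; split=> //; apply: lex_le0.
rewrite y0 eqxx /=; congr (_ :: _); apply/esym/all_filterP/allP => x xs.
by apply: contraNneq ys => x0; rewrite y0 -x0.
Qed.

Definition hamming_col (n : nat) (i : 'I_(2 ^ n).-1) : 'rV['F_2]_n :=
  nth 0 [seq x <- lex_enum n | x != 0] i.

Lemma punctured_truth_tableE (n : nat) (f : 'rV['F_2]_n -> 'F_2)
    (i : 'I_(2 ^ n).-1) :
  punctured_truth_table f 0 i = f (hamming_col i).
Proof. by rewrite !mxE lex_enumE. Qed.

Lemma sum_hamming_col (R : nmodType) (n : nat) (F : 'rV['F_2]_n -> R) :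
  \sum_x F x = F 0 + \sum_(i < (2 ^ n).-1) F (hamming_col i).
Proof.
have size_nz : size [seq x <- lex_enum n | x != 0] = (2 ^ n).-1.
  by rewrite -size_lex_enum [in RHS]lex_enumE.
rewrite -big_enum /= -(perm_big _ (permEl (perm_sort (@lex_le n) _))) /=.
rewrite -/(lex_enum n) lex_enumE big_cons; congr (_ + _).
by rewrite (big_nth 0) size_nz big_mkord.
Qed.

(** * Linearity of the even code *)

Lemma mem_hamming_code (n : nat) (v : 'rV['F_2]_(2 ^ n).-1) :
  (v \in hamming_code n) = (\sum_i v 0 i *: hamming_col i == 0).
Proof.
rewrite inE; suff -> : hammingH n *m v^T = (\sum_i v 0 i *: hamming_col i)^T.
  by rewrite -[X in _ == X]trmx0 (inj_eq trmx_inj).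
apply/matrixP => j k; rewrite ord1 !mxE summxE; apply: eq_bigr => i _.
by rewrite !mxE mulrC.
Qed.

Lemma natr_wt (m : nat) (v : 'rV['F_2]_m) : (wt v)%:R = \sum_i v 0 i.
Proof.
rewrite /wt cardsE -sum1_card natr_sum big_mkcond /=; apply: eq_bigr => i _.
by rewrite unfold_in /=; case: (F2_cases (v 0 i)) => ->.
Qed.

Lemma odd_wt (m : nat) (v : 'rV['F_2]_m) : odd (wt v) = (\sum_i v 0 i != 0).
Proof.
rewrite -natr_wt -[LHS]negbK; congr (~~ _).
by rewrite -(dvdn_pcharf (pchar_Fp (erefl (prime 2)))) dvdn2.
Qed.

(** Over ['F_2] the parity of the weight is the sum of the coordinates, so both conditions are
    linear in [v]. *)
Lemma mem_even_code (n : nat) (v : 'rV['F_2]_(2 ^ n).-1) :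
  (v \in even_code n) =
  (\sum_i v 0 i *: hamming_col i == 0) && (\sum_i v 0 i == 0).
Proof. by rewrite inE mem_hamming_code odd_wt negbK. Qed.

Lemma even_code0 (n : nat) : 0 \in even_code n.
Proof.
rewrite mem_even_code !big1 ?eqxx // => i _; rewrite !mxE //.
by rewrite scale0r.
Qed.

Lemma even_codeDr (n : nat) (v w : 'rV['F_2]_(2 ^ n).-1) :
  v \in even_code n -> (v + w \in even_code n) = (w \in even_code n).
Proof.
rewrite !mem_even_code => /andP[/eqP Hv /eqP ev].
under eq_bigr do rewrite mxE scalerDl.
under [X in _ && (X == _)]eq_bigr do rewrite mxE.
by rewrite !big_split /= Hv ev !add0r.
Qed.

Lemma hamming_distDr (m : nat) (v w : 'rV['F_2]_m) :
  hamming_dist v (v + w) = wt w.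
Proof.
apply: eq_card => i; rewrite !inE mxE.
by rewrite -{1}[v 0 i]addr0 (inj_eq (addrI _)) eq_sym.
Qed.

(** * The eigenvector equation *)

Lemma char_vec_neq0 (R : numFieldType) (n : nat) (u : 'rV['F_2]_(2 ^ n).-1) :
  char_vec R u != 0.
Proof.
(* The entry at the zero codeword is 1. *)
apply/negP => /eqP/matrixP/(_ (enum_rank_in (even_code0 n) 0) 0)/eqP.
by rewrite !mxE enum_rankK_in ?even_code0 // dotF2_0r signF2_0 oner_eq0.
Qed.

(** The graph is a Cayley graph of the group [even_code n] with the weight-4 codewords as connection
    set, so each character of the group is an eigenvector: substitute [v + w] for the neighbour of
    [v]. *)
Lemma adjacency_char_vec (R : comPzRingType) (n : nat)
    (u : 'rV['F_2]_(2 ^ n).-1) :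
  adjacency_mx R (even_code n) (@G4 n) *m char_vec R u
    = lambda R u *: char_vec R u.
Proof.
apply/matrixP => i k; rewrite !mxE.
set v := enum_val i; have vC : v \in even_code n by apply: enum_valP.
under eq_bigr do rewrite !mxE.
rewrite -(big_enum_val (fun w => (G4 v w)%:R * signF2 R (dotF2 u w))) /=.
rewrite (reindex_inj (addrI v)) /= /lambda mulr_suml big_mkcondr /=.
apply: eq_big => [w|w _]; first exact: even_codeDr.
rewrite /G4 hamming_distDr dotF2Dr signF2D.
by case: eqP => _; rewrite ?mul0r // mul1r mulrC.
Qed.

(** * Elementary symmetric functions and Newton's identities *)

Lemma coef_prod_1DX (R : comNzRingType) (I : finType) (h : I -> R) (k : nat) :
  (\prod_i (1 + h i *: 'X))`_k
    = \sum_(J : {set I} | #|J| == k) \prod_(i in J) h i.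
Proof.
under eq_bigr do rewrite addrC.
rewrite bigA_distr coef_sum [RHS]big_mkcond; apply: eq_bigr => J _.
rewrite -big_mkcond /= scaler_prod prodr_const coefZ coefXn eq_sym.
by case: eqP; rewrite ?mulr1 ?mulr0.
Qed.

(** Induction on the list, using [e_k(i :: s) = e_k(s) + h_i e_(k-1)(s)]. The factors 2, 6, 24 are
    the [k!] that clear denominators, as [R] need not allow division. *)
Lemma newton4 (R : comNzRingType) (I : Type) (r : seq I) (h : I -> R) :
  let p k := \sum_(i <- r) h i ^+ k in
  24%:R * (\prod_(i <- r) (1 + h i *: 'X))`_4
    = p 1 ^+ 4 - 6%:R * p 1 ^+ 2 * p 2 + 3%:R * p 2 ^+ 2
      + 8%:R * p 1 * p 3 - 6%:R * p 4.
Proof.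
move=> p; rewrite {}/p; set e := fun s => \prod_(i <- s) (1 + h i *: 'X).
pose p s k := \sum_(i <- s) h i ^+ k.
have pS i s k : p (i :: s) k = h i ^+ k + p s k by rewrite /p big_cons.
have eS i s k : (e (i :: s))`_k.+1 = (e s)`_k.+1 + h i * (e s)`_k.
  by rewrite /e big_cons mulrDl mul1r coefD -scalerAl coefZ coefXM.
have e0 s : (e s)`_0 = 1.
  elim: s => [|i s IHs]; first by rewrite /e big_nil coef1.
  by rewrite /e big_cons mulrDl mul1r coefD -scalerAl coefZ coefXM mulr0 addr0.
have pn k : p [::] k = 0 by rewrite /p big_nil.
have en k : (e [::])`_k.+1 = 0 by rewrite /e big_nil coef1.
have e1 s : (e s)`_1 = p s 1.
  by elim: s => [|i s IHs]; rewrite ?pn ?en // eS pS IHs e0; ring.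
have e2 s : 2%:R * (e s)`_2 = p s 1 ^+ 2 - p s 2.
  elim: s => [|i s IHs]; first by rewrite !pn en; ring.
  by rewrite eS !pS mulrDr IHs e1; ring.
have e3 s : 6%:R * (e s)`_3 = p s 1 ^+ 3 - 3%:R * p s 1 * p s 2 + 2%:R * p s 3.
  elim: s => [|i s IHs]; first by rewrite !pn en; ring.
  rewrite eS !pS mulrDr IHs.
  (* Only [2 e_2] is known as a polynomial in the power sums, so this multiple is exposed first. *)
  have -> : 6%:R * (h i * (e s)`_2) = 3%:R * h i * (2%:R * (e s)`_2) by ring.
  by rewrite e2; ring.
elim: r => [|i s IHs]; first by rewrite -/(e _) -!/(p _ _) !pn en; ring.
rewrite -/(e _) -!/(p _ _) in IHs *; rewrite eS !pS mulrDr IHs.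
have -> : 24%:R * (h i * (e s)`_3) = 4%:R * h i * (6%:R * (e s)`_3) by ring.
by rewrite e3; ring.
Qed.

(** * Words of given weight and twisted signs *)

Definition indicator (m : nat) (J : {set 'I_m}) : 'rV['F_2]_m :=
  \row_i (i \in J)%:R.

Lemma support_indicator (m : nat) (J : {set 'I_m}) :
  [set i | indicator J 0 i != 0] = J.
Proof. by apply/setP => i; rewrite inE mxE; case: (i \in J). Qed.

Lemma indicator_support (m : nat) (v : 'rV['F_2]_m) :
  indicator [set i | v 0 i != 0] = v.
Proof.
by apply/rowP => i; rewrite mxE inE; case: (F2_cases (v 0 i)) => ->.
Qed.

Lemma signF2_dot_indicator (R : comPzRingType) (m : nat) (u : 'rV['F_2]_m)
    (J : {set 'I_m}) :
  signF2 R (dotF2 u (indicator J)) = \prod_(i in J) signF2 R (u 0 i).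
Proof.
rewrite signF2_sum [RHS]big_mkcond; apply: eq_bigr => i _; rewrite mxE.
by case: (i \in J); rewrite ?mulr1 ?mulr0.
Qed.

(** Words of weight [k] correspond to [k]-subsets through their supports, and the sign of a word is
    the product of the signs over its support. *)
Lemma sum_wt (R : comNzRingType) (m : nat) (u : 'rV['F_2]_m) (k : nat) :
  \sum_(s : 'rV['F_2]_m | wt s == k) signF2 R (dotF2 u s)
    = (\prod_i (1 + signF2 R (u 0 i) *: 'X))`_k.
Proof.
rewrite coef_prod_1DX (reindex (@indicator m)) /=; last first.
  exists (fun v : 'rV['F_2]_m => [set i | v 0 i != 0]) => [J _|v _].
    exact: support_indicator.
  exact: indicator_support.
apply: eq_big => [J|J _]; last exact: signF2_dot_indicator.
by rewrite /wt support_indicator.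
Qed.

(* If u is the punctured truth table of f, this is that of x |-> f x + a . x. *)
Definition twist (n : nat) (u : 'rV['F_2]_(2 ^ n).-1) (a : 'rV['F_2]_n) :
    'rV['F_2]_(2 ^ n).-1 :=
  \row_i (u 0 i + dotF2 a (hamming_col i)).

(** By bilinearity, twisting by [a] multiplies the sign of [s] by the character [a] of its
    syndrome. *)
Lemma dotF2_twist (n : nat) (u s : 'rV['F_2]_(2 ^ n).-1) (a : 'rV['F_2]_n) :
  dotF2 (twist u a) s = dotF2 u s + dotF2 a (\sum_i s 0 i *: hamming_col i).
Proof.
rewrite (big_morph _ (dotF2Dr a) (dotF2_0r a)) -big_split; apply: eq_bigr => i _.
rewrite mxE mulrDl; congr (_ + _); rewrite mulr_suml; apply: eq_bigr => j _.
by rewrite mxE -mulrA [s 0 i * _]mulrC.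
Qed.

(* Averaging over the twists projects onto the zero-syndrome words. *)
Lemma sum_twist (R : numFieldType) (n : nat) (u : 'rV['F_2]_(2 ^ n).-1) :
  \sum_a \sum_(s | wt s == 4) signF2 R (dotF2 (twist u a) s)
    = 2%:R ^+ n * lambda R u.
Proof.
rewrite exchange_big /= /lambda mulr_sumr.
(* Weight 4 is even, so the parity condition is automatic here. *)
rewrite [RHS](eq_bigl (fun s => (wt s == 4) && (s \in hamming_code n))); last first.
  by move=> s; rewrite /even_code inE andbC; case: (wt s =P 4) => //= ->;
    rewrite andbT.
rewrite [RHS]big_mkcondr; apply: eq_bigr => s _.
under eq_bigr do rewrite dotF2_twist signF2D.
rewrite -mulr_sumr sum_signF2_dotF2 -mem_hamming_code.
by case: ifP => _; rewrite ?mul0r ?mulr0 // mul1r mulrC.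
Qed.

(** * Moments of the Walsh transform and the final count *)

Lemma sum_walsh (R : numFieldType) (n : nat) (f : 'rV['F_2]_n -> 'F_2) :
  \sum_a walsh R f a = 2%:R ^+ n * signF2 R (f 0).
Proof.
rewrite exchange_big (bigD1 0) //= [X in _ + X]big1 => [|x /negPf x_neq0].
  under eq_bigr do rewrite signF2D.
  by rewrite -mulr_sumr sum_signF2_dotF2 eqxx mul1r addr0 mulrC.
under eq_bigr do rewrite signF2D.
by rewrite -mulr_sumr sum_signF2_dotF2 x_neq0 mul0r mulr0.
Qed.

Lemma parseval (R : numFieldType) (n : nat) (f : 'rV['F_2]_n -> 'F_2) :
  \sum_a walsh R f a ^+ 2 = (2%:R ^+ n) ^+ 2.
Proof.
have oppF2 (x : 'rV['F_2]_n) : - x = x.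
  apply/rowP => i; rewrite mxE.
  by case: (F2_cases (x 0 i)) => ->; apply: val_inj.
under eq_bigr do rewrite expr2 big_distrlr /=.
rewrite exchange_big /=.
under eq_bigr => x _.
  (* For fixed [x] and [y] the sum over [a] is that of the character at [x + y], which is nonzero
     unless [y = x]. *)
  rewrite exchange_big (bigD1 x) //= [X in _ + X]big1 => [|y yx]; last first.
    under eq_bigr do
      rewrite !signF2D mulrACA -signF2D -(signF2D _ (dotF2 _ _)) -dotF2Dr.
    rewrite -mulr_sumr sum_signF2_dotF2 addr_eq0 oppF2 eq_sym.
    by rewrite (negPf yx) mul0r mulr0.
  under eq_bigr do rewrite -expr2 signF2_sqr.
  rewrite sumr_const card_mx card_Fp // mul1n natrX addr0.
over.
by rewrite sumr_const card_mx card_Fp // mul1n -[LHS]mulr_natr natrX expr2.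
Qed.

Lemma sum_signF2_twist (R : pzRingType) (n : nat) (f : 'rV['F_2]_n -> 'F_2)
    (a : 'rV['F_2]_n) :
  f 0 = 0 ->
  \sum_i signF2 R (twist (punctured_truth_table f) a 0 i) = walsh R f a - 1.
Proof.
(* The subtracted 1 is the term at [x = 0], which puncturing removes. *)
move=> f0; rewrite /walsh sum_hamming_col f0 dotF2_0r addr0 signF2_0 addrAC.
rewrite subrr add0r; apply: eq_bigr => i _.
by rewrite mxE punctured_truth_tableE.
Qed.

Theorem proposition3 (R : numFieldType) (n : nat) (hn : (2 <= n)%N)
    (f : 'rV['F_2]_n -> 'F_2) (hf0 : f 0 = 0)
    (u : 'rV['F_2]_(2 ^ n).-1) (hu : u = punctured_truth_table f) :
  [/\ char_vec R u != 0,
      adjacency_mx R (even_code n) (@G4 n) *m char_vec R u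
        = lambda R u *: char_vec R u
    & 24%:R * lambda R u
        = (2%:R ^+ n)^-1
            * (\sum_(a : 'rV['F_2]_n) (walsh R f a ^+ 4 - 4%:R * walsh R f a ^+ 3))
          - 3%:R * 2%:R ^+ (2 * n) + 14%:R * 2%:R ^+ n - 8%:R].
Proof.
split; first exact: char_vec_neq0; first exact: adjacency_char_vec.
set N : R := 2%:R ^+ n; have N_neq0 : N != 0 by rewrite expf_neq0 ?pnatr_eq0.
have card_cols : (2 ^ n).-1%:R = N - 1 :> R.
  by rewrite -subn1 natrB ?expn_gt0 // natrX.
(* Newton's identity with [p_1 = p_3 = W - 1] and [p_2 = p_4 = N - 1], expanded in powers of [W]. *)
have newton a : 24%:R * \sum_(s | wt s == 4) signF2 R (dotF2 (twist u a) s)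
    = (walsh R f a ^+ 4 - 4%:R * walsh R f a ^+ 3)
      + (20%:R - 6%:R * N) * walsh R f a ^+ 2
      + (12%:R * N - 32%:R) * walsh R f a + (3%:R * N ^+ 2 - 18%:R * N + 24%:R).
  rewrite sum_wt newton4.
  have odd_pow k : \sum_i signF2 R (twist u a 0 i) ^+ k.*2.+1 = walsh R f a - 1.
    rewrite -(sum_signF2_twist _ _ hf0) -hu; apply: eq_bigr => i _.
    by rewrite exprS -mul2n exprM signF2_sqr expr1n mulr1.
  have even_pow k : \sum_i signF2 R (twist u a 0 i) ^+ k.*2 = N - 1.
    rewrite -card_cols -[X in X%:R]card_ord -sumr_const; apply: eq_bigr => i _.
    by rewrite -mul2n exprM signF2_sqr expr1n.
  by rewrite (odd_pow 0) (odd_pow 1) (even_pow 1) (even_pow 2); ring.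
have -> : 24%:R * lambda R u = N^-1 * (24%:R * (N * lambda R u)) by field.
rewrite -sum_twist mulr_sumr; under eq_bigr do rewrite newton.
(* The lower-order terms sum to [(20 - 6N)N^2 + (12N - 32)N + N(3N^2 - 18N + 24) = N(-3N^2 + 14N -
   8)]. *)
rewrite 3!big_split /= -!mulr_sumr parseval sum_walsh hf0 signF2_0.
rewrite sumr_const card_mx card_Fp // mul1n -[X in _ + X]mulr_natr natrX -/N.
by rewrite mulnC exprM -/N; field.
Qed.
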